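(* Let $\mathscr{C}$ be a Gabidulin-based UD-$(r,\delta)$-LRC, i.e. a linear $[n,k,d]_{q^t}$ code obtained by the construction described in the context from parameters $\{(n_j,r_j,\delta_j)\}_{j\in[s]}$ with $n_j=m_j(r_j+\delta_j-1)$, and suppose the parameters satisfy the ordered $(r,\delta)$ condition $$r_1\le r_2\le\cdots\le r_s,\qquad \delta_1\ge\delta_2\ge\cdots\ge\delta_s .$$ Then $\mathscr{C}$ is distance optimal: its minimum Hamming distance attains with equality the upper bound valid for all linear codes with $\{(n_j,r_j,\delta_j)\}_{j\in[s]}$-locality, that is, $$d = n-k+1-\sum_{j=1}^{s^*-1}(n_j-k_j)-\left(\left\lceil\frac{k-\sum_{j=1}^{s^*-1}k_j}{r_{s^*}}\right\rceil-1\right)(\delta_{s^*}-1),$$ where $k_j=m_jr_j$ for $j\in[s]$ and $$s^*=\min\Big\{j\in[s]\ \Big|\ \sum_{j'=1}^{j}k_{j'}\ge k\Big\}.$$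
   Context: For an integer $i$, $[i]=\{1,\dots,i\}$. An $[n,k,d]_{q}$ code is a linear code over $\mathbb{F}_q$ of length $n$, dimension $k\ge1$ and minimum Hamming distance $d$. MDS codes are linear codes with $d=n-k+1$. Gabidulin code: for $t\ge N\ge k$, an $[N,k]_{q^t}$ Gabidulin code encodes a message $(a_1,\dots,a_k)\in\mathbb{F}_{q^t}^k$ as $(f(x_1),\dots,f(x_N))$, where $f(x)=\sum_{i=1}^k a_i x^{q^{i-1}}$ and $x_1,\dots,x_N\in\mathbb{F}_{q^t}$ are fixed points linearly independent over $\mathbb{F}_q$. Locality: given a partition $[n]=\bigsqcup_{j=1}^s\mathcal{N}_j$ with $|\mathcal{N}_j|=n_j$, a linear code $\mathscr{C}$ of length $n$ has $\{(n_j,r_j,\delta_j)\}_{j\in[s]}$-locality if for every $j\in[s]$ and $i\in\mathcal{N}_j$ there is $\mathcal{S}_i\subset\mathcal{N}_j$ with $i\in\mathcal{S}_i$, $|\mathcal{S}_i|\le r_j+\delta_j-1$ and $d(\mathscr{C}|_{\mathcal{S}_i})\ge\delta_j$, where $\mathscr{C}|_{\mathcal{S}_i}$ is the restriction of $\mathscr{C}$ to the coordinates in $\mathcal{S}_i$. Construction (Gabidulin-based UD-$(r,\delta)$-LRC): let $r_j,\delta_j,m_j$ ($j\in[s]$) be positive integers, $n_j=m_j(r_j+\delta_j-1)$, $n=\sum_{j=1}^s n_j$, and assume $k\le n_{\mathrm{Gab}}:=\sum_{j=1}^s m_jr_j\le t$. The linear $[n,k,d]_{q^t}$ code is built as follows.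 (1) Precode $k$ information symbols (in $\mathbb{F}_{q^t}$) using a Gabidulin code of length $n_{\mathrm{Gab}}$. (2) Partition the Gabidulin codeword symbols into $\sum_{j=1}^s m_j$ local groups, with exactly $m_j$ groups of size $r_j$ for each $j\in[s]$. (3) Encode each local group of size $r_j$ (as a row vector, multiplied by the generator matrix) using an $[r_j+\delta_j-1,r_j,\delta_j]_q$ MDS code (over the base field $\mathbb{F}_q$; such MDS codes are assumed to be given). The codeword is the concatenation of all encoded local groups, and $\mathcal{N}_j$ is the set of coordinates belonging to the $m_j$ encoded groups of type $j$. For general parameters the upper bound uses the following $k_j$: with $n_j=p_j(r_j+\delta_j-1)+q_j$, $0\le q_j\le r_j+\delta_j-2$ and $m_j=n_j/(r_j+\delta_j-1)$, $k_j=\lfloor m_j\rfloor r_j$ if $q_j\le\delta_j-2$ and $k_j=n_j-\lceil m_j\rceil(\delta_j-1)$ otherwise; for integer $m_j$, as here, this equals $m_jr_j$. *)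

(* Defs.v *)
From HB Require Import structures.
From mathcomp Require Import all_boot all_order all_algebra all_field.

Set Implicit Arguments.
Unset Strict Implicit.
Unset Printing Implicit Defensive.

Import Order.TTheory GRing.Theory Num.Theory.
Local Open Scope ring_scope.

Definition hweight (K : fieldType) (n : nat) (c : 'rV[K]_n) : nat :=
  #|[set i | c 0 i != 0]|.

(* The zero code satisfies this for every [d] (minimum over the empty set). *)
Definition min_dist_geq (K : fieldType) (n : nat) (C : {vspace 'rV[K]_n})
    (d : nat) : Prop :=
  forall c, c \in C -> c != 0 -> (d <= hweight c)%N.

Definition is_min_dist (K : fieldType) (n : nat) (C : {vspace 'rV[K]_n})
    (d : nat) : Prop :=
  (exists c, [/\ c \in C, c != 0 & hweight c = d]) /\ min_dist_geq C d.

Definition is_code (K : fieldType) (n : nat) (C : {vspace 'rV[K]_n})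
    (k d : nat) : Prop :=
  \dim C = k /\ is_min_dist C d.

Definition row_code (K : fieldType) (k n : nat) (G : 'M[K]_(k, n)) :
    {vspace 'rV[K]_n} :=
  limg (linfun (mulmxr G : 'rV[K]_k -> 'rV[K]_n)).

Definition restrict_code (K : fieldType) (n : nat) (C : {vspace 'rV[K]_n})
    (S : {set 'I_n}) : {vspace 'rV[K]_#|S|} :=
  (linfun (fun c : 'rV[K]_n => colsub (@enum_val _ (mem S)) c) @: C)%VS.

(* Indices in [s] = {1, ..., s} are represented by 'I_s, i.e. shifted by 1. *)
Definition sized_partition (n s : nat) (nn : 'I_s -> nat)
    (N : 'I_s -> {set 'I_n}) : Prop :=
  [/\ forall i j, i != j -> [disjoint N i & N j],
      \bigcup_j N j = [set: 'I_n]
    & forall j, #|N j| = nn j].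

Definition has_locality (K : fieldType) (n s : nat) (C : {vspace 'rV[K]_n})
    (nn r delta : 'I_s -> nat) (N : 'I_s -> {set 'I_n}) : Prop :=
  sized_partition nn N /\
  forall j i, i \in N j ->
    exists S : {set 'I_n},
      [/\ i \in S, S \subset N j, (#|S| <= r j + delta j - 1)%N
        & min_dist_geq (restrict_code C S) (delta j)].

Definition is_sstar (s : nat) (kk : 'I_s -> nat) (k : nat) (j0 : 'I_s) : Prop :=
  (k <= \sum_(i < s | (i <= j0)%N) kk i)%N /\
  forall j : 'I_s, (k <= \sum_(i < s | (i <= j)%N) kk i)%N -> (j0 <= j)%N.

(* All subtractions are in int, so nothing is truncated. *)
Definition locality_bound (s : nat) (nn kk r delta : 'I_s -> nat) (n k : nat)
    (j0 : 'I_s) : int :=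
  n%:Z - k%:Z + 1
  - \sum_(j < s | (j < j0)%N) ((nn j)%:Z - (kk j)%:Z)
  - (Num.ceil ((k%:R - \sum_(j < s | (j < j0)%N) (kk j)%:R) / (r j0)%:R : rat)
       - 1) * ((delta j0)%:Z - 1).

Section Construction.

Variables (F : finFieldType) (L : fieldExtType F).
Variables (s : nat) (r delta m : 'I_s -> nat).

Definition group_len (j : 'I_s) : nat := (r j + delta j - 1)%N.
Definition block_len (j : 'I_s) : nat := (m j * group_len j)%N.
Definition code_len : nat := (\sum_(j < s) block_len j)%N.
Definition gab_len : nat := (\sum_(j < s) m j * r j)%N.

(* Positions of symbols before, resp. after, the local encodings:
   (j, (u, b)) is the b-th symbol of the u-th local group of type j. *)
Definition pre_slot : finType := {j : 'I_s & 'I_(m j) * 'I_(r j)}%type.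
Definition post_slot : finType := {j : 'I_s & 'I_(m j) * 'I_(group_len j)}%type.

Definition gabidulin_encode (N : nat) (x : N.-tuple L) (k : nat)
    (a : 'rV[L]_k) : 'rV[L]_N :=
  \row_l \sum_(i < k) a 0 i * tnth x l ^+ (#|F| ^ i).

(* [g] assigns the Gabidulin symbols to the local groups, [G j u] generates the
   code used on the u-th group of type j, and [lab] says which encoded symbol
   is stored in each coordinate; [g] and [lab] are meant to be bijective. *)
Variables (x : gab_len.-tuple L) (g : pre_slot -> 'I_gab_len).
Variable G : forall j : 'I_s, 'I_(m j) -> 'M[F]_(r j, group_len j).
Variable lab : 'I_code_len -> post_slot.

Definition local_word (c : 'rV[L]_gab_len) (j : 'I_s) (u : 'I_(m j)) :
    'rV[L]_(group_len j) :=
  (\row_(b < r j) c 0 (g (existT _ j (u, b)))) *m map_mx (in_alg L) (G u).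

Definition lrc_encode (k : nat) (a : 'rV[L]_k) : 'rV[L]_code_len :=
  \row_i local_word (gabidulin_encode x a) (tagged (lab i)).1
           0 (tagged (lab i)).2.

(* [linfun] is meaningful only on linear maps. *)
Lemma lrc_encode_is_linear k : linear (@lrc_encode k).
Proof.
move=> c a b; apply/rowP => i; rewrite !mxE big_distrr /= -big_split /=.
apply: eq_bigr => l _; rewrite !mxE mulrA -mulrDl; congr (_ * _).
rewrite big_distrr /= -big_split /=; apply: eq_bigr => e _.
by rewrite !mxE mulrDl mulrA.
Qed.

Definition gabidulin_lrc (k : nat) : {vspace 'rV[L]_code_len} :=
  limg (linfun (@lrc_encode k)).

Definition lrc_block (j : 'I_s) : {set 'I_code_len} :=
  [set i | tag (lab i) == j].

End Construction.

(* Main.v *)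
(* Upper bound: for a code D and a set T of coordinates, follow the dimension of
   the subcode of D vanishing on T.  Adding a local repair set of type j to T
   lowers it by at most r_j, while |T| plus the dimension grows by at least
   delta_j - 1.  Doing this m_j times for each j < s*, and
   ceil((k - sum_(j < s* ) k_j) / r_(s* )) - 1 times for s*, leaves a nonzero
   subcode, to which the Singleton argument applies.
   Lower bound: each coordinate of a codeword is the value of a linearized
   polynomial of q-degree < k at some point of L, and points coming from
   coordinates with at most r_j of them in each local group are F-independent.
   So the zeros of a nonzero codeword, capped at r_j per group, number at most
   k - 1, and the excess is at most delta_j - 1 for each group holding at least
   r_j zeros.  Under the ordering condition the total excess is largest when
   the groups of smallest type are filled first. *)
Require Import Defs.
From HB Require Import structures.
From mathcomp Require Import all_boot all_order all_algebra all_field.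
From mathcomp Require Import zify.

Set Implicit Arguments.
Unset Strict Implicit.
Unset Printing Implicit Defensive.

Import Order.TTheory GRing.Theory Num.Theory.
Local Open Scope ring_scope.

Lemma exists_subset_card (T : finType) (B : {set T}) p :
  (p <= #|B|)%N -> exists2 A : {set T}, A \subset B & #|A| = p.
Proof.
move=> pB; exists [set y in take p (enum B)].
  by apply/subsetP => y; rewrite inE => /mem_take; rewrite mem_enum.
rewrite cardsE (card_uniqP _) ?take_uniq ?enum_uniq // size_take -cardE.
by case: ltngtP pB.
Qed.

(* [lia] identifies atoms syntactically, so the two forms in which mathcomp
   presents the finite type ['I_n] have to be unified first. *)
Ltac clia := unfold reverse_coercion in *; lia.

(** * Shortened codes and the upper bound on the distance *)

Section Shortening.

Variables (K : fieldType) (n : nat).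
Implicit Types (D : {vspace 'rV[K]_n}) (S T : {set 'I_n}) (c : 'rV[K]_n).

Lemma mem_restrict_code D S c :
  c \in D -> colsub (@enum_val _ (mem S)) c \in restrict_code D S.
Proof. by move=> cD; rewrite -lfunE memv_img. Qed.

Lemma hweight_colsub S c :
  hweight (colsub (@enum_val _ (mem S)) c) = #|[set i in S | c 0 i != 0]|.
Proof.
rewrite /hweight -(card_imset _ (@enum_val_inj _ (mem S))); apply: eq_card => i.
rewrite !inE; apply/imsetP/andP => [[l]|[iS ci]].
  by rewrite inE mxE => cl ->; split; rewrite ?enum_valP.
by exists (enum_rank_in iS i); rewrite ?inE ?mxE enum_rankK_in.
Qed.

Lemma hweight_complement c : hweight c = (n - #|[set i | c 0%R i == 0%R]|)%N.
Proof.
rewrite /hweight; set Z := [set i | c 0 i == 0].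
have -> : [set i | c 0 i != 0] = ~: Z by apply/setP=> i; rewrite !inE.
by rewrite cardsCs setCK card_ord.
Qed.

Lemma hweight_eq0 c : (hweight c == 0)%N = (c == 0).
Proof.
rewrite cards_eq0; apply/eqP/eqP => [/setP w0|->]; last first.
  by apply/setP => i; rewrite !inE mxE eqxx.
by apply/rowP => i; have := w0 i; rewrite !inE mxE => /negPn/eqP.
Qed.

(** The words keep their length [n] instead of losing the coordinates in [T], so subcodes for
    different [T] live in one space and can be compared by inclusion. *)
Definition shortened D T : {vspace 'rV[K]_n} :=
  (D :&: \bigcap_(i in T) lker (linfun (mulmxr (delta_mx i (ord0 : 'I_1)))))%VS.

Lemma mem_lker_coord c i :
  (c \in lker (linfun (mulmxr (delta_mx i (ord0 : 'I_1))))) = (c 0 i == 0).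
Proof.
rewrite memv_ker lfunE /= -colE; apply/eqP/eqP => [/matrixP/(_ 0 0)|c0].
  by rewrite !mxE.
by apply/matrixP => a b; rewrite !mxE !ord1.
Qed.

Lemma mem_shortened D T c :
  reflect (c \in D /\ forall i, i \in T -> c 0 i = 0) (c \in shortened D T).
Proof.
rewrite memv_cap; apply: (iffP andP) => [] [cD cT]; split=> //.
  move=> i iT; apply/eqP; rewrite -mem_lker_coord.
  by move/subv_bigcapP: cT; apply.
by apply/subv_bigcapP => i iT; rewrite [(_ <= _)%VS]mem_lker_coord cT.
Qed.

Lemma shorten0 D : shortened D set0 = D.
Proof. by rewrite /shortened big_set0 capvf. Qed.

Lemma shortenS D S T : S \subset T -> (shortened D T <= shortened D S)%VS.
Proof.
move=> /subsetP ST; apply/subvP => c /mem_shortened [cD cT].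
by apply/mem_shortened; split=> // i /ST /cT.
Qed.

Lemma dim_shorten_setU1 D T i :
  (\dim (shortened D T) <= (\dim (shortened D (i |: T))).+1)%N.
Proof.
set f := linfun (mulmxr (delta_mx i (ord0 : 'I_1))) : 'Hom('rV[K]_n, 'rV[K]_1).
have -> : shortened D (i |: T) = (shortened D T :&: lker f)%VS.
  apply/vspaceP => c; rewrite memv_cap mem_lker_coord.
  apply/mem_shortened/andP => [[cD cT]|[/mem_shortened[cD cT] /eqP ci]].
    split; last by rewrite cT ?setU11.
    by apply/mem_shortened; split=> // l lT; rewrite cT ?setU1r.
  by split=> // l /setU1P[->|/cT].
have d1 : (\dim (f @: shortened D T) <= 1)%N.
  by rewrite (leq_trans (dimvS (subvf _))) // dimvf dim_matrix.
by rewrite -(limg_ker_dim f (shortened D T)) -[leqRHS]addn1 leq_add2l.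
Qed.

Lemma dim_shorten_setU D T S :
  (\dim (shortened D T) <= \dim (shortened D (T :|: S)) + #|S :\: T|)%N.
Proof.
move: {2}#|_| (erefl #|S :\: T|) => p; elim: p T => [|p IH] T cST.
  rewrite (_ : T :|: S = T) ?leq_addr //; apply/setUidPl.
  by rewrite -setD_eq0 -cards_eq0 cST.
have /card_gt0P[i iST] : (0 < #|S :\: T|)%N by rewrite cST.
have iS : i \in S by case/setDP: iST.
have eqD : S :\: (i |: T) = (S :\: T) :\ i.
  by apply/setP=> l; rewrite !inE negb_or andbA.
have c1 : #|S :\: (i |: T)| = p.
  by move: cST; rewrite eqD (cardsD1 i) iST add1n => -[].
have := IH (i |: T) c1; rewrite c1 cST.
have -> : i |: T :|: S = T :|: S.
  by rewrite -setUA; apply/setUidPr; rewrite sub1set inE iS orbT.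
by have := dim_shorten_setU1 D T i; lia.
Qed.

(* Zeroing one more coordinate at a time costs one dimension each, so a
   one-dimensional subcode with many common zeros is reached. *)
Lemma singleton_shorten D T :
  (0 < \dim (shortened D T))%N ->
  exists c, [/\ c \in shortened D T, c != 0
             & (hweight c + #|T| + \dim (shortened D T) <= n.+1)%N].
Proof.
move: {2}#|_| (leqnn #|~: T|) => p; elim: p T => [|p IH] T cT dT.
  have [c0 cS] : vpick (shortened D T) != 0 /\ vpick (shortened D T) \in shortened D T.
    by rewrite vpick0 -dimv_eq0 -lt0n memv_pick.
  case/eqP: c0; apply/rowP => i; rewrite mxE; case/mem_shortened: cS => _; apply.
  apply: contraTT cT => iT; rewrite -ltnNge; apply/card_gt0P.
  by exists i; rewrite inE.
have [c0 cS] : vpick (shortened D T) != 0 /\ vpick (shortened D T) \in shortened D T.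
  by rewrite vpick0 -dimv_eq0 -lt0n memv_pick.
set c := vpick _ in c0 cS.
have [d1|d1] := leqP (\dim (shortened D T)) 1.
  exists c; split=> //.
  have : (hweight c <= #|~: T|)%N.
    apply/subset_leq_card/subsetP => i; rewrite !inE; apply: contraNN => iT.
    by case/mem_shortened: cS => _ ->.
  by have := cardsC T; rewrite card_ord; lia.
have [i ci] : exists i, c 0 i != 0.
  apply/existsP; apply: contraNT c0; rewrite negb_exists => /forallP c0.
  by apply/eqP/rowP => i; rewrite mxE; apply/eqP; have:= c0 i; rewrite negbK.
have iT : i \notin T.
  by apply: contra ci => iT; case/mem_shortened: cS => _ ->.
have cT1 : #|i |: T| = #|T|.+1 by rewrite cardsU1 iT.
have dT1 := dim_shorten_setU1 D T i.
have := cardsC T; have := cardsC (i |: T); rewrite card_ord => e1 e2.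
have [||c' [c'S c'0 wc']] := IH (i |: T); [clia|clia|].
exists c'; split=> //; last by clia.
by apply: (subvP (shortenS D (subsetUr [set i] T))).
Qed.

(** A word vanishing on [T] restricts to [S] with support inside [S :\: T], hence with weight below
    [delta]; such a restriction must be zero. *)
Lemma shorten_restrict_code D S T delta :
  min_dist_geq (restrict_code D S) delta -> (#|S :\: T| < delta)%N ->
  (shortened D T <= shortened D (T :|: S))%VS.
Proof.
move=> dS ST; apply/subvP => c /mem_shortened [cD cT]; apply/mem_shortened.
split=> // i; rewrite inE => /orP[/cT //|iS].
have wc : (hweight (colsub (@enum_val _ (mem S)) c) < delta)%N.
  rewrite hweight_colsub (leq_ltn_trans _ ST) //.
  apply/subset_leq_card/subsetP => l; rewrite !inE => /andP[-> cl].
  by rewrite andbT; apply: contra cl => /cT ->.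
have [/rowP c0|c0] := eqVneq (colsub (@enum_val _ (mem S)) c) 0.
  by have:= c0 (enum_rank_in iS i); rewrite !mxE enum_rankK_in.
by have := dS _ (mem_restrict_code S cD) c0; rewrite leqNgt wc.
Qed.

(** Choose [delta - 1] coordinates [A] in [S :\: T]. Zeroing the rest of [S] forces zeros on [A] by
    the local distance, so the dimension pays only for the coordinates of [S :\: T] outside [A], at
    most [r] of them, while the zero set gains all of [S :\: T]. *)
Lemma shorten_step D S T r delta :
  (0 < delta)%N -> (#|S| <= r + delta - 1)%N ->
  min_dist_geq (restrict_code D S) delta ->
  ~~ (shortened D T <= shortened D (T :|: S))%VS ->
  (\dim (shortened D T) <= \dim (shortened D (T :|: S)) + r)%N /\
  (\dim (shortened D T) + #|T| + (delta - 1)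
     <= \dim (shortened D (T :|: S)) + #|T :|: S|)%N.
Proof.
move=> d0 cS dS nST.
have geST : (delta <= #|S :\: T|)%N.
  by rewrite leqNgt; apply: contra nST; apply: shorten_restrict_code.
have [|A AST cA] := @exists_subset_card _ (S :\: T) (delta - 1).
  by lia.
have AS : A \subset S by apply: subset_trans AST (subsetDl _ _).
set T1 := T :|: (S :\: A).
have T1S : T1 :|: S = T :|: S.
  by apply/setP => i; rewrite !inE; case: (i \in S); rewrite ?orbT ?andbF ?orbF.
have sT1 : (shortened D T1 <= shortened D (T :|: S))%VS.
  rewrite -T1S; apply: (shorten_restrict_code dS).
  apply: (@leq_ltn_trans #|A|); last by rewrite cA; lia.
  apply/subset_leq_card/subsetP => i; rewrite !inE => /andP[].
  by rewrite negb_or => /andP[_]; case: (i \in S); rewrite ?andbT ?negbK ?andbF.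
have := dimvS sT1.
have := dim_shorten_setU D T (S :\: A).
have -> : #|(S :\: A) :\: T| = (#|S :\: T| - (delta - 1))%N.
  rewrite -cA -(setIidPr AST) -cardsD; apply: eq_card => i.
  by rewrite !inE; case: (i \in T); case: (i \in S); rewrite ?andbF ?andbT.
have cU : #|T :|: S| = (#|T| + #|S :\: T|)%N.
  have -> : T :|: S = T :|: (S :\: T) by rewrite setDE setUIr setUCr setIT.
  rewrite cardsU (_ : T :&: _ = set0) ?cards0 ?subn0 //.
  by apply/setP => i; rewrite !inE; case: (i \in T).
have : (#|S :\: T| <= #|S|)%N by apply/subset_leq_card/subsetDl.
rewrite cU -/T1; lia.
Qed.

Lemma shorten_block D (B : {set 'I_n}) T r delta m p :
  (0 < delta)%N -> #|B| = (m * (r + delta - 1))%N -> [disjoint T & B] ->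
  (forall i, i \in B -> exists S : {set 'I_n},
     [/\ i \in S, S \subset B, (#|S| <= r + delta - 1)%N
       & min_dist_geq (restrict_code D S) delta]) ->
  (p <= m)%N ->
  exists T' : {set 'I_n},
    [/\ T \subset T', T' \subset T :|: B,
        (\dim (shortened D T) <= \dim (shortened D T') + p * r)%N
      & (\dim (shortened D T) + #|T| + p * (delta - 1)
           <= \dim (shortened D T') + #|T'|)%N].
Proof.
move=> d0 cB TB loc; elim: p => [|p IH] pm.
  by exists T; rewrite subxx subsetUl !mul0n !addn0.
have [T' [TT' T'B dT' eT']] := IH (ltnW pm).
(* Either the current subcode already vanishes on all of [B], and adding [B] costs no dimension
   while gaining its full size; or some [i] in [B] is not yet zero, and its repair set makes a
   genuine step. *)
have [cl|] := boolP [forall i in B, (shortened D T' <= shortened D [set i])%VS].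
  exists (T :|: B); rewrite subsetUl subxx.
  have : (shortened D T' <= shortened D (T :|: B))%VS.
    apply/subvP => c cT'; apply/mem_shortened; split; first by case/mem_shortened: cT'.
    move=> i; rewrite inE => /orP[iT|iB].
      by case/mem_shortened: cT' => _; apply; apply: (subsetP TT').
    have := subvP (forall_inP cl i iB) _ cT'.
    by case/mem_shortened => _; apply; rewrite set11.
  move/dimvS => dTB; have cTB : #|T :|: B| = (#|T| + #|B|)%N.
    by move: TB; rewrite -setI_eq0 => /eqP TB; rewrite cardsU TB cards0 subn0.
  split=> //; first by nia.
  rewrite cTB cB; nia.
rewrite negb_forall_in => /exists_inP[i iB ni].
have [S [iS SB cS dS]] := loc i iB.
have [|d1 d2] := @shorten_step D S T' r delta d0 cS dS.
  apply: contra ni => /subv_trans; apply; apply: shortenS.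
  by rewrite sub1set inE iS orbT.
exists (T' :|: S); split; [|by rewrite subUset T'B (subset_trans SB) ?subsetUr|nia|nia].
exact: subset_trans TT' (subsetUl _ _).
Qed.

Lemma exists_low_weight_codeword s D (nn r delta m p : 'I_s -> nat)
    (N : 'I_s -> {set 'I_n}) :
  (forall j, 0 < delta j)%N ->
  (forall j, nn j = m j * (r j + delta j - 1))%N ->
  has_locality D nn r delta N ->
  (forall j, p j <= m j)%N ->
  (\sum_j p j * r j < \dim D)%N ->
  exists c, [/\ c \in D, c != 0
    & (hweight c + \dim D + \sum_j p j * (delta j - 1) <= n.+1)%N].
Proof.
move=> d0 nnE [[disN _ cN] loc] pm ltD.
(* Induction over the list of types. The first clause records that [T] meets only blocks already
   treated, so the next block is disjoint from it. *)
have [T [_ d1 d2]] : exists T : {set 'I_n},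
  [/\ forall i j, i \in T -> i \in N j -> j \in index_enum 'I_s,
      (\dim D <= \dim (shortened D T) + \sum_j p j * r j)%N
    & (\dim D + \sum_j p j * (delta j - 1) <= \dim (shortened D T) + #|T|)%N].
  elim: (index_enum _) (index_enum_uniq 'I_s) => [_|j js IH /andP[jjs ujs]].
    exists set0; rewrite !big_nil shorten0 cards0 !addn0.
    by split=> // i j; rewrite inE.
  have [T [Tjs d1 d2]] := IH ujs.
  have TN : [disjoint T & N j].
    rewrite -setI_eq0; apply/eqP/setP => i; rewrite !inE; apply/andP => -[iT iN].
    by move: jjs; rewrite (Tjs i).
  have cNj : #|N j| = (m j * (r j + delta j - 1))%N by rewrite cN nnE.
  have [T' [_ T'N d1' d2']] :=
    shorten_block (d0 j) cNj TN (loc j) (pm j).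
  exists T'; rewrite !big_cons; split; [|lia|lia] => i j' iT' iN.
  rewrite inE; have /setUP[iT|iNj] := subsetP T'N _ iT'.
    by rewrite (Tjs i) ?orbT.
  have [//|nj] := eqVneq j' j.
  by have := disN _ _ nj; rewrite -setI_eq0 => /eqP/setP/(_ i); rewrite !inE iN iNj.
(* The total cost [\sum_j p j * r j] is below [\dim D], so the subcode is still nonzero. *)
have [|c [cS c0 wc]] := @singleton_shorten D T; first by lia.
by exists c; split=> //; [case/mem_shortened: cS|lia].
Qed.

End Shortening.

(** * Counting by groups and an exchange argument *)

Lemma card_fibers (I T : finType) (h : I -> T) (W : {set I}) :
  #|W| = (\sum_t #|[set i in W | h i == t]|)%N.
Proof.
rewrite -sum1_card (partition_big h predT) //=; apply: eq_bigr => t _.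
by rewrite -sum1_card; apply: eq_bigl => i; rewrite inE.
Qed.

(** Serves to trim the zeros of a codeword to at most [r j] in each local group of type [j]. *)
Lemma exists_capped_subset (I T : finType) (h : I -> T) (W : {set I})
    (cap : T -> nat) :
  exists2 W' : {set I}, W' \subset W
    & forall t, #|[set i in W' | h i == t]|
                = minn #|[set i in W | h i == t]| (cap t).
Proof.
have /fin_all_exists[A Ap] : forall t, exists A : {set I},
    A \subset [set i in W | h i == t] /\
    #|A| = minn #|[set i in W | h i == t]| (cap t).
  move=> t; pose B := [set i in W | h i == t].
  by have [A sA cA] := exists_subset_card (geq_minl #|B| (cap t)); exists A.
exists [set i | i \in A (h i)].
  apply/subsetP => i; rewrite inE => iA.
  by have := subsetP (Ap (h i)).1 i iA; rewrite inE => /andP[].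
move=> t; rewrite -(Ap t).2; apply: eq_card => i; rewrite !inE.
apply/andP/idP => [[iA /eqP <-] //|iA].
by have := subsetP (Ap t).1 i iA; rewrite inE => /andP[_ /eqP ->]; rewrite eqxx.
Qed.

(** Exchange argument: items of [A] cost at most [R] and are worth at least [E], the others the
    reverse. Cancelling [A :&: B], the budget gives [#|B :\: A| * R <= #|A :\: B| * R + z], so [B]
    has at most [z %/ R] more outside items than it omits from [A], each worth at most [E]. *)
Lemma knapsack_prefix (I : finType) (A B : {set I}) (rho eps : I -> nat)
    (R E z : nat) :
  (0 < R)%N ->
  (forall i, i \in A -> rho i <= R /\ E <= eps i)%N ->
  (forall i, i \notin A -> R <= rho i /\ eps i <= E)%N ->
  (\sum_(i in B) rho i <= \sum_(i in A) rho i + z)%N ->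
  (\sum_(i in B) eps i <= \sum_(i in A) eps i + z %/ R * E)%N.
Proof.
move=> R0 hA hB.
have sA f : (\sum_(i in A) f i = \sum_(i in A :&: B) f i + \sum_(i in A :\: B) f i)%N.
  by rewrite (big_setID B).
have sB f : (\sum_(i in B) f i = \sum_(i in A :&: B) f i + \sum_(i in B :\: A) f i)%N.
  by rewrite (big_setID A) setIC.
rewrite !sA !sB => le_rho.
have e1 : (#|B :\: A| * R <= \sum_(i in B :\: A) rho i)%N.
  by rewrite -sum_nat_const leq_sum // => i /setDP[_ /hB[]].
have e2 : (\sum_(i in A :\: B) rho i <= #|A :\: B| * R)%N.
  by rewrite -sum_nat_const leq_sum // => i /setDP[/hA[]].
have e3 : (\sum_(i in B :\: A) eps i <= #|B :\: A| * E)%N.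
  by rewrite -sum_nat_const leq_sum // => i /setDP[_ /hB[]].
have e4 : (#|A :\: B| * E <= \sum_(i in A :\: B) eps i)%N.
  by rewrite -sum_nat_const leq_sum // => i /setDP[/hA[]].
have : (#|B :\: A| <= #|A :\: B| + z %/ R)%N.
  by rewrite -divnMDl // leq_divRL //; lia.
by move/(leq_mul (leqnn E)); nia.
Qed.

(** * MDS codes over the base field and linearized polynomials *)

Section BaseField.

Variables (F : finFieldType) (L : fieldExtType F).

Lemma mem_row_code (k n : nat) (G : 'M[F]_(k, n)) (u : 'rV[F]_k) :
  u *m G \in row_code G.
Proof. by apply/memv_imgP; exists u; rewrite ?memvf // lfunE. Qed.

(* Some coordinate of the word over an [F]-basis of [L] is a nonzero word of
   the code over [F]. *)
Lemma hweight_mulmx_ext (k n d : nat) (G : 'M[F]_(k, n)) (v : 'rV[L]_k) :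
  min_dist_geq (row_code G) d -> v *m map_mx (in_alg L) G != 0 ->
  (d <= hweight (v *m map_mx (in_alg L) G))%N.
Proof.
set w := v *m _ => dG w0.
have [l wl] : exists l, w 0 l != 0.
  apply/existsP; apply: contraNT w0; rewrite negb_exists => /forallP w0.
  by apply/eqP/rowP => i; rewrite [RHS]mxE; apply/eqP; have:= w0 i; rewrite negbK.
have [b wb] : exists b, coord (vbasis {:L}) b (w 0 l) != 0.
  apply/existsP; apply: contraNT wl; rewrite negb_exists => /forallP wb.
  rewrite (coord_vbasis (memvf (w 0 l))) big1 // => b _.
  by have:= wb b; rewrite negbK => /eqP ->; rewrite scale0r.
pose u := \row_i coord (vbasis {:L}) b (v 0 i).
have uG i : (u *m G) 0 i = coord (vbasis {:L}) b (w 0 i).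
  rewrite !mxE linear_sum /=; apply: eq_bigr => e _.
  by rewrite !mxE mulr_algr linearZ /= mulrC.
have uG0 : u *m G != 0.
  by apply: contraNneq wb => /rowP/(_ l); rewrite uG [RHS]mxE => ->.
apply: leq_trans (dG _ (mem_row_code _ _) uG0) _.
apply/subset_leq_card/subsetP => i; rewrite !inE uG.
by apply: contra => /eqP ->; rewrite linear0.
Qed.

(** Suppose [c l 0] is nonzero. A codeword vanishing on [I :\ l] but not at [l], paired with [c],
    leaves a single nonzero term, against [G *m c = 0]. If there is no such codeword, the words
    vanishing on [I] have dimension at least [k - #|I| + 1], and the Singleton argument yields one
    of weight at most [n - k], which is below [d]. *)
Lemma mds_columns_free (k n d : nat) (G : 'M[F]_(k, n)) (I : {set 'I_n})
    (c : 'cV[F]_n) :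
  \dim (row_code G) = k -> min_dist_geq (row_code G) d -> (n < k + d)%N ->
  (#|I| <= k)%N -> (forall l, l \notin I -> c l 0 = 0) -> G *m c = 0 -> c = 0.
Proof.
move=> dimG dG nkd cI cz Gc; apply/colP => l; rewrite [RHS]mxE; apply/eqP.
apply/negPn/negP => cl; have lI : l \in I by apply: contraNT cl => /cz ->.
have [le|/subvPn[w wT wl]] := boolP
    (shortened (row_code G) (I :\ l) <= shortened (row_code G) (l |: (I :\ l)))%VS.
  have := dim_shorten_setU (row_code G) set0 (I :\ l).
  rewrite shorten0 set0U setD0 dimG => dT.
  have := dimvS le; rewrite setD1K // => dI.
  have cI1 := cardsD1 l I; rewrite lI in cI1.
  have [|w [/mem_shortened[wG _] w0 ww]] := @singleton_shorten _ _ (row_code G) I.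
    by clia.
  by have := dG w wG w0; clia.
case/mem_shortened: (wT) => wG wz; case/memv_imgP: (wG) => u _.
rewrite lfunE /= => wE.
have : (w *m c) 0 0 = 0 by rewrite wE -mulmxA Gc mulmx0 mxE.
rewrite mxE (bigD1 l) //= big1 => [|e el]; last first.
  have [eI|/cz ->] := boolP (e \in I); last by rewrite mulr0.
  by rewrite wz ?mul0r // !inE el.
rewrite addr0 => /eqP; rewrite mulf_eq0 (negPf cl) orbF => wl0.
case/negP: wl; apply/mem_shortened; split=> // e; rewrite inE => /orP[|/wz //].
by rewrite inE => /eqP ->; apply/eqP.
Qed.

Definition linearized_eval (k : nat) (a : 'rV[L]_k) (z : L) : L :=
  \sum_(i < k) a 0 i * z ^+ (#|F| ^ i).

Lemma pchar_nat_cardX i : ([pchar L]).-nat (#|F| ^ i)%N.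
Proof.
have [p p_pr pF] := finPcharP F.
have -> : #|F| = (p ^ logn p #|F|)%N by exact: (card_pprimeChar pF).
by rewrite -expnM pnatX pnatE // pchar_lalg pF.
Qed.

(** Each [#|F| ^ i] is a power of the characteristic, so raising to it is additive, and it fixes the
    elements of [F]. Linearity is over [F], not over [L]. *)
Lemma linearized_eval_is_linear k (a : 'rV[L]_k) : linear (linearized_eval a).
Proof.
move=> c y z; rewrite /linearized_eval scaler_sumr -big_split /=.
apply: eq_bigr => i _; rewrite exprDn_pchar ?pchar_nat_cardX // exprZn mulrDr.
rewrite -scalerAr; congr (_ *: _ + _).
by elim: (val i) => [|e IH]; rewrite ?expr1 // expnS exprM expf_card.
Qed.

HB.instance Definition _ k (a : 'rV[L]_k) :=
  GRing.isLinear.Build F L L *:%R (linearized_eval a) (linearized_eval_is_linear a).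

(* A nonzero linearized polynomial of q-degree less than k has at most q^(k-1)
   roots, and the F-span of independent roots consists of roots. *)
Lemma card_independent_roots (I : finType) (W : {set I}) (y : I -> L) k
    (a : 'rV[L]_k) :
  a != 0 -> (forall i, i \in W -> linearized_eval a (y i) = 0) ->
  (forall c : I -> F, (forall i, i \notin W -> c i = 0) ->
     \sum_i c i *: y i = 0 -> forall i, c i = 0) ->
  (#|W| < k)%N.
Proof.
move=> a0 yW yfree; set q := #|F|.
have q1 : (1 < q)%N := finRing_gt1 F.
have [i ai] : exists i, a 0 i != 0.
  apply/existsP; apply: contraNT a0; rewrite negb_exists => /forallP a0.
  by apply/eqP/rowP => i; rewrite [RHS]mxE; apply/eqP; have:= a0 i; rewrite negbK.
pose P := \sum_(i < k) a 0 i *: 'X^(q ^ i).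
have Proot z : root P z = (linearized_eval a z == 0).
  rewrite /root horner_sum /linearized_eval; congr (_ == 0).
  by apply: eq_bigr => e _; rewrite hornerZ hornerXn.
have P0 : P != 0.
  apply: contra ai => /eqP P0; have := congr1 (fun p : {poly L} => p`_(q ^ i)) P0.
  rewrite coef0 coef_sum (bigD1 i) //= big1 => [|e ei].
    by rewrite coefZ coefXn eqxx mulr1 addr0 => ->.
  by rewrite coefZ coefXn eqn_exp2l // eq_sym
      (negPf (ei : (e : nat) != i)) mulr0.
have sP : (size P <= (q ^ k.-1).+1)%N.
  apply: leq_trans (size_sum _ _ _) _; apply/bigmax_leqP => e _.
  apply: leq_trans (size_scale_leq _ _) _; rewrite size_polyXn ltnS.
  by rewrite leq_exp2l //; have := ltn_ord e; lia.
pose lc (c : {ffun I -> F}) := \sum_i c i *: y i.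
(* The coefficient functions range over the [q ^ #|W|] maps to [F] that are 0 outside [W]. *)
pose rs := map lc (enum (pffun_on 0 W (predT : {pred F}))).
have rsP : all (root P) rs.
  apply/allP => z /mapP[c]; rewrite mem_enum => /pffun_onP[/subsetP sc _] ->.
  rewrite Proot linear_sum big1 // => e _; rewrite linearZ /=.
  have [/yW ->|eW] := boolP (e \in W); first by rewrite scaler0.
  have /eqP -> : c e == 0 by apply: contraNT eW => ce; apply: sc.
  by rewrite scale0r.
have urs : uniq rs.
  rewrite map_inj_in_uniq ?enum_uniq // => c c'; rewrite !mem_enum.
  move=> /pffun_onP[/subsetP sc _] /pffun_onP[/subsetP sc' _] e.
  have cz (b : {ffun I -> F}) : (forall x, x \in 0.-support b -> x \in W) ->
      forall x, x \notin W -> b x = 0.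
    by move=> sb x xW; apply/eqP; apply: contraNT xW => bx; apply: sb.
  apply/ffunP => j; apply/eqP; rewrite -subr_eq0; apply/eqP.
  apply: (yfree (fun x => c x - c' x)) => [x xW|].
    by rewrite (cz c sc x xW) (cz c' sc' x xW) subr0.
  under eq_bigr => x _ do rewrite scalerBl.
  by rewrite sumrB; apply/eqP; rewrite subr_eq0; apply/eqP.
have := max_poly_roots P0 rsP urs.
rewrite size_map -cardE card_pffun_on -/q => lt.
have : (q ^ #|W| <= q ^ k.-1)%N by rewrite -ltnS (leq_trans lt).
by rewrite leq_exp2l //; have := ltn_ord i; lia.
Qed.

End BaseField.

(** * Locality and weights of the Gabidulin-based code *)

Section GabidulinLRC.

Variables (F : finFieldType) (L : fieldExtType F).
Variables (s : nat) (r delta m : 'I_s -> nat).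
Variables (x : (gab_len r m).-tuple L).
Variables (g : pre_slot r m -> 'I_(gab_len r m)).
Variable G : forall j : 'I_s, 'I_(m j) -> 'M[F]_(r j, group_len r delta j).
Variable lab : 'I_(code_len r delta m) -> post_slot r delta m.
Hypotheses (r_gt0 : forall j, (0 < r j)%N) (delta_gt0 : forall j, (0 < delta j)%N).
Variables (g' : 'I_(gab_len r m) -> pre_slot r m).
Variables (lab' : post_slot r delta m -> 'I_(code_len r delta m)).
Hypotheses (gK : cancel g g') (g'K : cancel g' g).
Hypotheses (labK : cancel lab lab') (lab'K : cancel lab' lab).
Hypothesis x_free : free x.
Hypothesis G_mds : forall (j : 'I_s) (u : 'I_(m j)),
  is_code (row_code (G u)) (r j) (delta j).

Let n := code_len r delta m.

HB.instance Definition _ k :=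
  GRing.isLinear.Build L _ _ *:%R (lrc_encode x g G lab (k:=k))
    (@lrc_encode_is_linear _ _ _ _ _ _ x g G lab k).

Lemma mem_gabidulin_lrc k c :
  reflect (exists a, c = lrc_encode x g G lab (k:=k) a)
          (c \in gabidulin_lrc x g G lab k).
Proof.
apply: (iffP memv_imgP) => [[a _ ->]|[a ->]]; exists a; rewrite ?lfunE ?memvf //.
Qed.

Definition local_group : finType := {j : 'I_s & 'I_(m j)}.

Definition group_of (i : 'I_n) : local_group :=
  existT _ (tag (lab i)) (tagged (lab i)).1.

Definition group_set (t : local_group) : {set 'I_n} := [set i | group_of i == t].

Definition group_coord (t : local_group) (l : 'I_(group_len r delta (tag t))) :
    'I_n :=
  lab' (existT _ (tag t) (tagged t, l)).

Lemma lab_group_coord t l :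
  lab (@group_coord t l) = existT _ (tag t) (tagged t, l).
Proof. exact: lab'K. Qed.

Lemma group_of_coord t l : group_of (@group_coord t l) = t.
Proof. by rewrite /group_of lab_group_coord; case: t l. Qed.

Lemma group_coord_inj t : injective (@group_coord t).
Proof.
move=> l l' /(congr1 lab); rewrite !lab_group_coord => /eqP.
by rewrite eq_Tagged /= => /eqP[].
Qed.

Lemma group_coordE i :
  i = @group_coord (group_of i) (tagged (lab i)).2.
Proof.
apply: (can_inj labK); rewrite lab_group_coord /=.
by case: (lab i) => j [u l].
Qed.

Lemma card_group_set_cond t (P : pred 'I_n) :
  #|[set i in group_set t | P i]| = #|[set l | P (@group_coord t l)]|.
Proof.
rewrite -(card_imset _ (@group_coord_inj t)); apply: eq_card => i.
rewrite !inE; apply/andP/imsetP => [[/eqP <- Pi]|[l]].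
  by exists (tagged (lab i)).2; rewrite ?inE -?group_coordE.
by rewrite inE => Pl ->; rewrite group_of_coord.
Qed.

Lemma card_group_set t : #|group_set t| = group_len r delta (tag t).
Proof.
have <- : #|[set i in group_set t | predT i]| = #|group_set t|.
  by apply: eq_card => i; rewrite !inE andbT.
rewrite card_group_set_cond -[RHS]card_ord.
by apply: eq_card => l; rewrite !inE.
Qed.

Lemma big_slot (q : 'I_s -> nat) (V : nmodType)
    (h : {j : 'I_s & ('I_(m j) * 'I_(q j))%type} -> V) :
  \sum_p h p = \sum_j \sum_(u < m j) \sum_(b < q j) h (existT _ j (u, b)).
Proof.
under [RHS]eq_bigr => j _ do rewrite pair_big /=.
by rewrite sig_big_dep /=; apply: eq_bigr => -[j [u b]].
Qed.

Lemma big_local_group (E : 'I_s -> nat) (P : pred 'I_s) :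
  (\sum_(t : local_group | P (tag t)) E (tag t) = \sum_(j | P j) m j * E j)%N.
Proof.
transitivity (\sum_(j | P j) \sum_(u < m j) E j)%N.
  by rewrite sig_big_dep /=; apply: eq_bigl => t; rewrite andbT.
by apply: eq_bigr => j _; rewrite sum_nat_const card_ord.
Qed.

Lemma lrc_encode_group_coord k (a : 'rV[L]_k) t l :
  lrc_encode x g G lab a 0 (@group_coord t l)
  = local_word g G (gabidulin_encode x a) (tagged t) 0 l.
Proof. by rewrite mxE lab_group_coord. Qed.

(** The local generator matrices have entries in [F], so by [F]-linearity local encoding can be
    applied to the evaluation points instead of the values. *)
Lemma lrc_encode_linearized k (a : 'rV[L]_k) t l :
  lrc_encode x g G lab a 0 (@group_coord t l)
  = linearized_eval a
      (\sum_(b < r (tag t)) G (tagged t) b l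
         *: tnth x (g (existT _ (tag t) (tagged t, b)))).
Proof.
rewrite lrc_encode_group_coord mxE linear_sum; apply: eq_bigr => b _.
by rewrite !mxE mulr_algr linearZ.
Qed.

Lemma gabidulin_lrc_sized_partition :
  sized_partition (block_len r delta m) (lrc_block lab).
Proof.
split=> [i j ij||j].
- rewrite -setI_eq0; apply/eqP/setP => e; rewrite !inE.
  by apply: contraNF ij => /andP[/eqP <-].
- by apply/setP => i; rewrite inE; apply/bigcupP; exists (tag (lab i)); rewrite ?inE.
rewrite (card_fibers group_of) (bigID (fun t : local_group => tag t == j)) /=.
rewrite [X in (_ + X)%N]big1 ?addn0 => [|t tj]; last first.
  apply/eqP; rewrite cards_eq0; apply/eqP/setP => i; rewrite !inE.
  by apply: contraNF tj => /andP[/eqP <- /eqP <-].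
rewrite -[RHS](big_pred1_eq addn j (fun j => m j * group_len r delta j)%N).
rewrite -big_local_group; apply: eq_bigr => t /eqP tj.
rewrite -card_group_set; apply: eq_card => i; rewrite !inE.
by case: (group_of i =P t) => [e|_]; rewrite ?andbF // -tj -e eqxx.
Qed.

(** The repair set of a coordinate is its whole local group: the restriction there consists of words
    of the local MDS code with scalars extended to [L], which keeps the distance. *)
Lemma gabidulin_lrc_locality k :
  has_locality (gabidulin_lrc x g G lab k) (block_len r delta m) r delta
    (lrc_block lab).
Proof.
split=> [|j i]; first exact: gabidulin_lrc_sized_partition.
rewrite inE => /eqP <-; exists (group_set (group_of i)).
split; first by rewrite inE.
- by apply/subsetP => i'; rewrite !inE => /eqP/(congr1 tag) e; apply/eqP.
- by rewrite card_group_set.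
move=> w /memv_imgP[c /mem_gabidulin_lrc[a ->] ->] {w}; rewrite lfunE /= => w0.
set t := group_of i.
have wE : hweight (colsub (@enum_val _ (mem (group_set t))) (lrc_encode x g G lab a))
    = hweight (local_word g G (gabidulin_encode x a) (tagged t)).
  rewrite hweight_colsub card_group_set_cond; apply: eq_card => l.
  by rewrite !inE lrc_encode_group_coord.
rewrite wE; apply: hweight_mulmx_ext; first exact: (G_mds _).2.2.
by rewrite -hweight_eq0 -[hweight _]wE hweight_eq0.
Qed.

(** The [k - 1] available independent roots fill all groups of types before [j0], at [r j] each, and
    the remaining [z] fill [z %/ r j0] groups of type [j0]. The last summand is the excess of zeros
    in that extremal distribution. *)
Lemma lrc_weight_bound k (a : 'rV[L]_k) (z : nat) (j0 : 'I_s) :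
  (forall i j : 'I_s, (i <= j)%N -> (r i <= r j)%N) ->
  (forall i j : 'I_s, (i <= j)%N -> (delta j <= delta i)%N) ->
  k = (\sum_(j < s | (j < j0)%N) m j * r j + z).+1 ->
  a != 0 ->
  (n < hweight (lrc_encode x g G lab a) + k
       + (\sum_(j < s | (j < j0)%N) m j * (delta j - 1)
          + z %/ r j0 * (delta j0 - 1)))%N.
Proof.
move=> r_mono delta_anti kE a0.
set W := [set i | lrc_encode x g G lab a 0 i == 0].
have [W' W'W cW'] := exists_capped_subset group_of W (fun t => r (tag t)).
have ltW' : (#|W'| < k)%N.
  (* [y i] is the point of [L] at which coordinate [i] evaluates the linearized polynomial. *)
  pose y i := \sum_(b < r (tag (lab i))) G (tagged (lab i)).1 b (tagged (lab i)).2
         *: tnth x (g (existT _ (tag (lab i)) ((tagged (lab i)).1, b))).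
  have yE t l : y (@group_coord t l) = \sum_(b < r (tag t)) G (tagged t) b l
         *: tnth x (g (existT _ (tag t) (tagged t, b))).
    by rewrite /y lab_group_coord.
  apply: (card_independent_roots (y := y) a0) => [i iW'|c cW'0 c_y i].
    have := subsetP W'W i iW'; rewrite inE => /eqP <-.
    by rewrite [in RHS](group_coordE i) lrc_encode_linearized -yE -group_coordE.
  (* [e p] is the total coefficient of the Gabidulin point in slot [p] once the relation among the
     [y i] is expanded; these points are free, so it vanishes. *)
  pose e (p : pre_slot r m) := \sum_l
     c (@group_coord (existT _ (tag p) (tagged p).1) l) * G (tagged p).1 (tagged p).2 l.
  have e0 p : e p = 0.
    rewrite -[p]gK; apply: (freeP x_free (fun q => e (g' q))).
    rewrite -[RHS]c_y [LHS](reindex g) /=; last exact/onW_bij/(Bijective gK).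
    rewrite [RHS](reindex lab') /=; last exact/onW_bij/(Bijective lab'K).
    rewrite !big_slot; apply: eq_bigr => j _; apply: eq_bigr => u _.
    transitivity (\sum_l \sum_b c (@group_coord (existT _ j u) l)
        *: (G u b l *: tnth x (g (existT _ j (u, b))))).
      rewrite exchange_big; apply: eq_bigr => b _ /=.
      rewrite gK scaler_suml -tnth_nth; apply: eq_bigr => l _.
      by rewrite scalerA.
    by apply: eq_bigr => l _; rewrite -scaler_sumr -(yE (existT _ j u)).
  rewrite (group_coordE i); set t := group_of i; set l0 := (tagged (lab i)).2.
  (* Within one group the coefficients form a vector killed by the generator matrix and supported on
     at most [r] columns. *)
  suff /colP/(_ l0) : (\col_l c (@group_coord t l)) = 0 by rewrite !mxE.
  have [dG [_ wG]] := G_mds (tagged t).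
  apply: (mds_columns_free (I := [set l | @group_coord t l \in W']) dG wG).
  - by have := delta_gt0 (tag t); have := r_gt0 (tag t); rewrite /group_len; lia.
  - apply: leq_trans (_ : #|[set i in W' | group_of i == t]| <= _)%N.
      rewrite -card_group_set_cond; apply/subset_leq_card/subsetP => i'.
      by rewrite !inE andbC.
    by rewrite cW' geq_minr.
  - by move=> l; rewrite inE mxE => /cW'0.
  apply/colP => b; rewrite [RHS]mxE -[RHS](e0 (existT _ (tag t) (tagged t, b))).
  by rewrite /e mxE; apply: eq_bigr => l _; rewrite mxE mulrC.
pose w t := #|[set i in W | group_of i == t]|.
pose A : {set local_group} := [set t : local_group | (tag t < j0)%N].
pose B : {set local_group} := [set t : local_group | (r (tag t) <= w t)%N].
(* A group has [r + delta - 1] coordinates, so capping at [r] discards at most [delta - 1] zeros,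
   and none outside [B]. *)
have w_le t : (w t <= minn (w t) (r (tag t)) + (t \in B) * (delta (tag t) - 1))%N.
  have : (w t <= group_len r delta (tag t))%N.
    rewrite -card_group_set; apply/subset_leq_card/subsetP => i.
    by rewrite !inE => /andP[].
  rewrite inE /group_len; have := delta_gt0 (tag t).
  by case: leqP; rewrite ?mul1n; lia.
have cW : (#|W| <= #|W'| + \sum_(t in B) (delta (tag t) - 1))%N.
  rewrite (card_fibers group_of W) (card_fibers group_of W') [in X in (_ + X)%N]big_mkcond.
  rewrite -big_split leq_sum //= => t _; rewrite cW'.
  by apply: leq_trans (w_le t) _; case: (t \in B); rewrite ?mul1n.
have rB : (\sum_(t in B) r (tag t) <= #|W'|)%N.
  rewrite (card_fibers group_of W') big_mkcond leq_sum //= => t _.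
  by rewrite cW' inE; case: ifP => // rw; rewrite leq_min rw leqnn.
have sA E : (\sum_(t in A) E (tag t) = \sum_(j < s | (j < j0)%N) m j * E j)%N.
  by rewrite -big_local_group; apply: eq_bigl => t; rewrite inE.
have kn : (\sum_(t in B) (delta (tag t) - 1) <=
   \sum_(j < s | (j < j0)%N) m j * (delta j - 1) + z %/ r j0 * (delta j0 - 1))%N.
  rewrite -(sA (fun j => delta j - 1)%N).
  (* Here [R = r j0] and [E = delta j0 - 1]; the ordering makes earlier types cheaper and more
     rewarding. The budget is [#|W'| <= k - 1]. *)
  apply: (knapsack_prefix (rho := fun t => r (tag t))) => // [t|t|].
  - rewrite inE => lt; split; first exact/r_mono/ltnW.
    by rewrite leq_sub2r // delta_anti // ltnW.
  - rewrite inE -leqNgt => lt; split; first exact: r_mono.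
    by rewrite leq_sub2r // delta_anti.
  - by rewrite (sA r) (leq_trans rB) // -ltnS -kE.
rewrite hweight_complement -/W -addnA.
apply: (@leq_ltn_trans (n - #|W| + #|W|)); first by rewrite addnC -leq_subLR.
by rewrite ltn_add2l (leq_ltn_trans cW) // -addSn leq_add.
Qed.

End GabidulinLRC.

(** * Arithmetic of the bound and distance optimality *)

Lemma sum_prefix_split (s : nat) (m E : 'I_s -> nat) (j0 : 'I_s) (q : nat) :
  (\sum_(j < s) (if (j < j0)%N then m j else if j == j0 then q else 0) * E j
   = \sum_(j < s | (j < j0)%N) m j * E j + q * E j0)%N.
Proof.
rewrite (bigID (fun j : 'I_s => (j < j0)%N)) /=; congr (_ + _)%N.
  by apply: eq_bigr => j ->.
rewrite (bigD1 j0) ?ltnn //= eqxx big1 ?addn0 // => j /andP[/negPf -> /negPf ->].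
by rewrite mul0n.
Qed.

(** Minimality at the predecessor of [j0] makes the sum of the earlier types smaller than [k]; for
    the first type that sum is empty and [0 < k] suffices. The successor lets [z] count roots, of
    which there are at most [k - 1]. *)
Lemma sstar_split (s : nat) (r m : 'I_s -> nat) (k : nat) (j0 : 'I_s) :
  (0 < k)%N -> is_sstar (fun j => m j * r j)%N k j0 ->
  exists z, k = (\sum_(j < s | (j < j0)%N) m j * r j + z).+1
            /\ (z < m j0 * r j0)%N.
Proof.
move=> k0 [kle kmin]; set K := (\sum_(j < s | _) _)%N.
have Kk : (K < k)%N.
  rewrite ltnNge; apply/negP => kK.
  have [j0_0|j0_gt0] := posnP j0.
    have K0 : K = 0%N by apply: big_pred0 => j; rewrite j0_0.
    by move: kK; rewrite K0 leqNgt k0.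
  have lt : (j0.-1 < s)%N by rewrite (leq_ltn_trans (leq_pred _)).
  suff /(kmin (Ordinal lt)) /= : (k <= \sum_(i < s | (i <= j0.-1)%N) m i * r i)%N.
    by rewrite leqNgt prednK ?leqnn.
  apply: leq_trans kK _; rewrite leq_eqVlt; apply/orP; left; apply/eqP.
  by apply: eq_bigl => j; rewrite -[in RHS]ltnS prednK.
exists (k - K.+1)%N; rewrite -addSn subnKC //; split=> //.
move: kle; rewrite (bigD1 j0) //=.
have -> : (\sum_(i < s | (i <= j0)%N && (i != j0)) m i * r i)%N = K.
  by apply: eq_bigl => j; rewrite ltn_neqAle andbC.
by lia.
Qed.

Lemma locality_boundE (s : nat) (r delta m : 'I_s -> nat) (n k z : nat)
    (j0 : 'I_s) :
  (forall j, 0 < r j)%N -> (forall j, 0 < delta j)%N ->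
  k = (\sum_(j < s | (j < j0)%N) m j * r j + z).+1 ->
  locality_bound (block_len r delta m) (fun j => m j * r j)%N r delta n k j0
  = n%:Z - k%:Z + 1
    - (\sum_(j < s | (j < j0)%N) m j * (delta j - 1)
       + z %/ r j0 * (delta j0 - 1))%N%:Z.
Proof.
move=> r0 d0 kE; rewrite /locality_bound PoszD opprD addrA.
have -> : \sum_(j < s | (j < j0)%N)
    ((block_len r delta m j)%:Z - (m j * r j)%N%:Z)
    = (\sum_(j < s | (j < j0)%N) m j * (delta j - 1))%N%:Z.
  rewrite (big_morph Posz PoszD (erefl _)); apply: eq_bigr => j _.
  apply/eqP; rewrite subr_eq -PoszD; apply/eqP; congr Posz.
  by rewrite /block_len /group_len; have := d0 j; nia.
have -> : (k%:R - \sum_(j < s | (j < j0)%N) (m j * r j)%N%:R : rat) = (z.+1)%:R.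
  by rewrite -natr_sum kE -addnS natrD addrC addKr.
(* The ceiling of [z.+1 / r j0] is [z %/ r j0 + 1], so the ceiling minus one in the bound is an
   integer quotient. *)
rewrite (@ceil_def _ _ (z %/ r j0).+1%:Z); last first.
  have r0' : 0 < (r j0)%:R :> rat by rewrite ltr0n.
  have -> : (z %/ r j0).+1%:Z - 1 = (z %/ r j0)%:Z by rewrite intS addrC addKr.
  rewrite ltr_pdivlMr // ler_pdivrMr // -!pmulrn -!natrM ltr_nat ler_nat.
  by rewrite ltnS leq_divM ltn_ceil.
by rewrite intS [1 + _]addrC addrK PoszM -subzn.
Qed.

Theorem theorem3 (F : finFieldType) (L : fieldExtType F) (t : nat)
    (s : nat) (r delta m : 'I_s -> nat) (k : nat)
    (r_gt0 : forall j, (0 < r j)%N)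
    (delta_gt0 : forall j, (0 < delta j)%N)
    (m_gt0 : forall j, (0 < m j)%N)
    (k_gt0 : (0 < k)%N)
    (dimL : \dim {:L} = t)
    (k_le : (k <= gab_len r m)%N)
    (gab_le : (gab_len r m <= t)%N)
    (x : (gab_len r m).-tuple L) (x_free : free x)
    (g : pre_slot r m -> 'I_(gab_len r m)) (g_bij : bijective g)
    (G : forall j : 'I_s, 'I_(m j) -> 'M[F]_(r j, group_len r delta j))
    (G_mds : forall (j : 'I_s) (u : 'I_(m j)),
       is_code (row_code (G j u)) (r j) (delta j))
    (lab : 'I_(code_len r delta m) -> post_slot r delta m)
    (lab_bij : bijective lab)
    (r_mono : forall i j : 'I_s, (i <= j)%N -> (r i <= r j)%N)
    (delta_anti : forall i j : 'I_s, (i <= j)%N -> (delta j <= delta i)%N)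
    (sstar : 'I_s)
    (sstarP : is_sstar (fun j => m j * r j)%N k sstar) :
  let n := code_len r delta m in
  let nn := block_len r delta m in
  let kk := (fun j => m j * r j)%N in
  let C := gabidulin_lrc x g G lab k in
  let B := locality_bound nn kk r delta n k sstar in
  [/\ has_locality C nn r delta (lrc_block lab),
      forall (K : finFieldType) (D : {vspace 'rV[K]_n})
             (N : 'I_s -> {set 'I_n}) (e : nat),
        is_code D k e -> has_locality D nn r delta N -> e%:Z <= B
    & exists2 d : nat, is_code C k d & d%:Z = B].
Proof.
move=> n nn kk C B.
have [g' gK g'K] := g_bij; have [lab' labK lab'K] := lab_bij.
have [z [kE zlt]] := sstar_split k_gt0 sstarP.
set Gam := (\sum_(j < s | (j < sstar)%N) m j * (delta j - 1)
            + z %/ r sstar * (delta sstar - 1))%N.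
have BE : B = n%:Z - k%:Z + 1 - Gam%:Z by apply: locality_boundE.
(* Repair sets used per type in the upper bound: all groups before [sstar], the ceiling minus one at
   [sstar], none after. *)
pose p (j : 'I_s) := (if (j < sstar)%N then m j
                      else if j == sstar then z %/ r sstar else 0)%N.
have pm j : (p j <= m j)%N.
  rewrite /p; case: ifP => // _; case: eqP => // ->.
  by rewrite ltnW // ltn_divLR.
have pGam : (\sum_j p j * (delta j - 1) = Gam)%N by apply: sum_prefix_split.
(* Makes the encoder injective: a nonzero message with zero codeword would give [n < k + Gam] by the
   weight bound. *)
have kGam : (k + Gam <= n)%N.
  rewrite (leq_trans (leq_add k_le (leqnn Gam))) // -pGam -big_split leq_sum //=.
  move=> j _; rewrite /block_len /group_len -addnBA // mulnDr leq_add2l.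
  by rewrite leq_mul.
have low (K : fieldType) (D : {vspace 'rV[K]_n}) N : \dim D = k ->
    has_locality D nn r delta N ->
    exists c, [/\ c \in D, c != 0 & (hweight c + k + Gam <= n.+1)%N].
  move=> dimD locD.
  have pr : (\sum_j p j * r j < \dim D)%N.
    by rewrite dimD sum_prefix_split [ltnRHS]kE ltnS leq_add2l leq_divM.
  have [c] :=
    exists_low_weight_codeword delta_gt0 (fun j => erefl (nn j)) locD pm pr.
  by rewrite dimD pGam; exists c.
have high (a : 'rV[L]_k) : a != 0 ->
    (n < hweight (lrc_encode x g G lab a) + k + Gam)%N.
  by apply: (lrc_weight_bound r_gt0 delta_gt0 gK g'K labK lab'K).
have locC : has_locality C nn r delta (lrc_block lab).
  exact: (gabidulin_lrc_locality _ _ labK lab'K G_mds).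
have dimC : \dim C = k.
  rewrite [LHS]limg_dim_eq ?dimvf ?dim_matrix; first exact: mul1n.
  apply/eqP; rewrite -subv0; apply/subvP => a; rewrite memv_cap memv_ker lfunE.
  case/andP => _ a0; rewrite memv0; apply: contraTT a0 => /high wa.
  by rewrite -hweight_eq0; apply: contraTneq wa => /= ->; rewrite -leqNgt.
split=> //.
- move=> K D N e [dimD [_ eD]] locD; have [c [cD c0 wc]] := low K D N dimD locD.
  by rewrite BE; have := eD c cD c0; lia.
have [c [cC c0 wc]] := low L C _ dimC locC.
have highC c' : c' \in C -> c' != 0 -> (n < hweight c' + k + Gam)%N.
  case/mem_gabidulin_lrc => a ->; have [->|/high //] := eqVneq a 0.
  by rewrite linear0 eqxx.
exists (hweight c).
  split=> //; split; first by exists c.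
  by move=> c' c'C c'0; have := highC c' c'C c'0; lia.
by have := highC c cC c0; move: wc; rewrite BE /n; lia.
Qed.
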